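(* There is a club (closed unbounded set) $A\subseteq\omega_1$ which is an antichain with respect to $\le_s$; that is, for any two distinct $\alpha,\beta\in A$ we have $\alpha\not\le_s\beta$ and $\beta\not\le_s\alpha$.
   Context: Work in ZFC. Ordinals are identified with the linear orders $(\eta,<)$. All languages are countable. A copy of a countable structure $\mathcal{A}$ is an isomorphic structure with domain $\omega$ (identified with its atomic diagram, a subset of $\omega$). $\Phi_e$ denotes the $e$-th Turing functional. For countable structures, $\mathcal{A}\le_s\mathcal{B}$ (Medvedev reducibility) means: there is $e\in\omega$ such that for every copy $B$ of $\mathcal{B}$, $\Phi_e^B$ is total and is (the atomic diagram of) a copy of $\mathcal{A}$. *)

(* Defs.v *)
From Stdlib Require Import Arith List.
Import ListNotations.

(* A countable ordinal is represented by a well-order on a subset of nat.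
   Every countable ordinal (finite or infinite) has such a representative. *)
Record WO : Type := {
  wdom : nat -> Prop;
  wrel : nat -> nat -> Prop;
  wrel_dom : forall x y, wrel x y -> wdom x /\ wdom y;
  wrel_irrefl : forall x, ~ wrel x x;
  wrel_trans : forall x y z, wrel x y -> wrel y z -> wrel x z;
  wrel_total : forall x y, wdom x -> wdom y -> x = y \/ wrel x y \/ wrel y x;
  wrel_wf : forall x, wdom x -> Acc wrel x
}.

Definition iso_rel (D1 : nat -> Prop) (R1 : nat -> nat -> Prop)
                   (D2 : nat -> Prop) (R2 : nat -> nat -> Prop) : Prop :=
  exists f : nat -> nat,
    (forall x, D1 x -> D2 (f x)) /\
    (forall x y, D1 x -> D1 y -> f x = f y -> x = y) /\
    (forall y, D2 y -> exists x, D1 x /\ f x = y) /\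
    (forall x y, D1 x -> D1 y -> (R1 x y <-> R2 (f x) (f y))).

Definition ord_eq (a b : WO) : Prop := iso_rel (wdom a) (wrel a) (wdom b) (wrel b).

Definition ord_lt (a b : WO) : Prop :=
  exists t, wdom b t /\ iso_rel (wdom a) (wrel a) (fun x => wrel b x t) (wrel b).

(* A "subset of omega_1": a predicate on representatives closed under iso *)
Definition ord_set_invariant (A : WO -> Prop) : Prop :=
  forall a b, ord_eq a b -> A a -> A b.

Definition unbounded (A : WO -> Prop) : Prop :=
  forall a, exists b, A b /\ ord_lt a b.

Definition closed (A : WO -> Prop) : Prop :=
  forall g, (exists a, ord_lt a g) ->
    (forall a, ord_lt a g -> exists b, A b /\ ord_lt a b /\ ord_lt b g) ->
    A g.

Definition club (A : WO -> Prop) : Prop :=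
  ord_set_invariant A /\ closed A /\ unbounded A.

(* Cantor pairing, a bijection nat*nat -> nat *)
Definition cpair (x y : nat) : nat := (x + y) * (x + y + 1) / 2 + y.

(* A copy of the linear order a: a structure with domain omega, given by
   its diagram D : nat -> bool, where D (cpair x y) = true iff x < y. *)
Definition is_copy (a : WO) (D : nat -> bool) : Prop :=
  iso_rel (fun _ => True) (fun x y => D (cpair x y) = true) (wdom a) (wrel a).

Inductive prf : Type :=
| PZero : prf
| PSucc : prf
| PProj : nat -> prf
| POracle : prf
| PComp : prf -> list prf -> prf
| PPrim : prf -> prf -> prf
| PMu : prf -> prf.

Section Eval.
Variable X : nat -> bool.

Inductive eval : prf -> list nat -> nat -> Prop :=
| eZero : forall v, eval PZero v 0
| eSucc : forall v, eval PSucc v (S (nth 0 v 0))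
| eProj : forall i v, eval (PProj i) v (nth i v 0)
| eOracle : forall v, eval POracle v (if X (nth 0 v 0) then 1 else 0)
| eComp : forall f gs v ws y, evals gs v ws -> eval f ws y -> eval (PComp f gs) v y
| ePrim0 : forall f g v y, nth 0 v 0 = 0 -> eval f (tl v) y -> eval (PPrim f g) v y
| ePrimS : forall f g v n z y, nth 0 v 0 = S n ->
    eval (PPrim f g) (n :: tl v) z -> eval g (n :: z :: tl v) y ->
    eval (PPrim f g) v y
| eMu : forall f v n, eval f (n :: v) 0 ->
    (forall m, m < n -> exists k, eval f (m :: v) (S k)) ->
    eval (PMu f) v n
with evals : list prf -> list nat -> list nat -> Prop :=
| esNil : forall v, evals [] v []
| esCons : forall g gs v w ws, eval g v w -> evals gs v ws -> evals (g :: gs) v (w :: ws).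
End Eval.

Definition computes (c : prf) (X : nat -> bool) (D : nat -> bool) : Prop :=
  forall n, eval X c [n] (if D n then 1 else 0).

Definition medv_le (a b : WO) : Prop :=
  exists c : prf, forall B, is_copy b B ->
    exists D, computes c B D /\ is_copy a D.

(* Main.v *)
Require Import Defs.
From Stdlib Require Import Arith List Lia Cantor Inverse_Image.
From Stdlib Require FinFun.
From Stdlib Require Import Classical ClassicalEpsilon.
From Stdlib Require Import FunctionalExtensionality PropExtensionality ProofIrrelevance.
From mathcomp Require ssrbool eqtype boolp wochoice.
Import ListNotations.

(* For a fixed functional [c], the type of the image of a copy of [be] is a partial function
   of [be]. A club of closure points of these countably many functions rules out reductions
   of larger ordinals to smaller ones. For the other direction, fix [c] and [al] and force
   with finite injective sequences of countable ordinals, a generic enumerating a copy.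
   "[c] maps the copy to a copy of [al]" is a Borel statement, hence decided by forcing
   relative to countably many sets of conditions. If [be] and [be'] are closed under
   witnesses for these sets and some copy of [be] is sent to [al], then a condition forces
   this, and such a condition is found below [be'] as well, so some copy of [be'] is also
   sent to [al]. Thus each [c] yields at most one [al] to which it sends larger points of
   the club, and discarding an initial segment removes these countably many [al]. *)

(** * Well-orderings and countable sets *)

Lemma well_ordering (T : Type) :
  exists lt : T -> T -> Prop,
    well_founded lt /\ forall x y, lt x y \/ x = y \/ lt y x.
Proof.
  set (T' := eqtype.Equality.Pack (eqtype.Equality.Class (boolp.gen_eqMixin T))).
  destruct (wochoice.well_ordering_principle T') as [R HR].
  assert (Hmin : forall P : T -> Prop, (exists x, P x) ->
            exists z, P z /\ forall x, P x -> R z x = true).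
  { intros P [x0 Px0].
    destruct (HR (fun x => boolp.asbool (P x))) as [z [[Pz lbz] _]].
    - exists x0. apply (ssrbool.introT (boolp.asboolP _)). exact Px0.
    - exists z. split.
      + exact (ssrbool.elimT (boolp.asboolP _) Pz).
      + intros x Px. apply lbz. apply (ssrbool.introT (boolp.asboolP _)). exact Px. }
  (* The strict part of [R]: since [R] gives least elements, a least non-accessible point would have
     only accessible predecessors. *)
  exists (fun x y => R y x = false). split.
  - intro a. apply NNPP. intro Ha.
    destruct (Hmin (fun x => ~ Acc (fun x y => R y x = false) x)) as [z [nz lbz]].
    { exists a. exact Ha. }
    apply nz. constructor. intros y Hy. apply NNPP. intro ny.
    specialize (lbz y ny). congruence.
  - intros x y.
    (* Uniqueness of the minimum of the pair [x], [y] gives antisymmetry of [R]. *)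
    destruct (HR (fun w => boolp.asbool (w = x \/ w = y))) as [z [[Hz lbz] Uz]].
    + exists x. apply (ssrbool.introT (boolp.asboolP _)). now left.
    + destruct (R x y) eqn:Exy; [destruct (R y x) eqn:Eyx|]; auto.
      right. left.
      assert (Rxx : forall w : T, R w w = true).
      { intro w. destruct (Hmin (fun v => v = w)) as [v [-> Hv]]; eauto. }
      transitivity z; [symmetry|]; apply Uz; split.
      1,3: apply (ssrbool.introT (boolp.asboolP _)); auto.
      all: intros w Hw; apply (ssrbool.elimT (boolp.asboolP _)) in Hw.
      all: destruct Hw as [-> | ->]; try apply Rxx; assumption.
Qed.

Definition countable {T : Type} (P : T -> Prop) : Prop :=
  exists f : T -> nat, forall x y, P x -> P y -> f x = f y -> x = y.

Lemma countable_sub (T : Type) (P Q : T -> Prop) :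
  (forall x, P x -> Q x) -> countable Q -> countable P.
Proof. intros HPQ [f Hf]. exists f. auto. Qed.

Lemma countable_nat (P : nat -> Prop) : countable P.
Proof. exists (fun n => n). auto. Qed.

Lemma countable_add (T : Type) (a : T) (P : T -> Prop) :
  countable P -> countable (fun x => x = a \/ P x).
Proof.
  intros [f Hf].
  exists (fun x => if excluded_middle_informative (x = a) then 0 else S (f x)).
  intros x y Hx Hy.
  destruct (excluded_middle_informative (x = a)), (excluded_middle_informative (y = a));
    intro E; try congruence.
  apply Hf; [tauto | tauto | congruence].
Qed.

Lemma pair_code_inj a b a' b' : to_nat (a, b) = to_nat (a', b') -> a = a' /\ b = b'.
Proof.
  intro E. apply (f_equal of_nat) in E. rewrite !cancel_of_to in E.
  injection E. auto.
Qed.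

Lemma countable_bigcup (I T : Type) (Q : I -> Prop) (P : I -> T -> Prop) :
  countable Q -> (forall i, Q i -> countable (P i)) ->
  countable (fun x => exists i, Q i /\ P i x).
Proof.
  intros [q Hq] HP.
  destruct (classic (exists x i, Q i /\ P i x)) as [[x0 [i0 [Qi0 _]]]|Hno].
  2:{ exists (fun _ => 0). intros x y [i Hi]. exfalso. eauto. }
  destruct (choice (fun i (f : T -> nat) => Q i -> forall x y, P i x -> P i y -> f x = f y -> x = y))
    as [f Hf].
  { intro i. destruct (classic (Q i)) as [Qi|nQi].
    - destruct (HP i Qi) as [f Hf]. exists f. auto.
    - exists (fun _ : T => 0). tauto. }
  (* An element may lie in several members of the union. [g] fixes one index for it, and its code is
     the pair of that index and its code in that member. *)
  destruct (choice (fun x i => (exists j, Q j /\ P j x) -> Q i /\ P i x)) as [g Hg].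
  { intro x. destruct (classic (exists j, Q j /\ P j x)) as [[j Hj]|nj].
    - exists j. auto.
    - exists i0. tauto. }
  exists (fun x => to_nat (q (g x), f (g x) x)).
  intros x y Hx Hy E. apply pair_code_inj in E as [E1 E2].
  apply Hg in Hx as [Qx Px]. apply Hg in Hy as [Qy Py].
  apply Hq in E1; auto. rewrite <- E1 in *. apply (Hf (g x)); auto.
Qed.

Lemma countable_range (I T : Type) (Q : I -> Prop) (h : I -> T) :
  countable Q -> countable (fun x => exists i, Q i /\ x = h i).
Proof.
  intro HQ. apply countable_bigcup; [exact HQ|].
  intros i _. exists (fun _ => 0). intros; congruence.
Qed.

Lemma Cantor_diagonal : ~ countable (fun _ : nat -> bool => True).
Proof.
  intros [f Hf].
  destruct (choice (fun n b => forall x, f x = n -> b = negb (x n))) as [d Hd].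
  { intro n. destruct (classic (exists x, f x = n)) as [[x Hx]|nx].
    - exists (negb (x n)). intros x' Hx'. f_equal.
      rewrite (Hf x x'); auto. congruence.
    - exists true. intros x Hx. exfalso. eauto. }
  specialize (Hd (f d) d eq_refl). now destruct (d (f d)).
Qed.

Lemma wf_least (T : Type) (lt : T -> T -> Prop) (P : T -> Prop) :
  well_founded lt -> (exists x, P x) -> exists x, P x /\ forall y, lt y x -> ~ P y.
Proof.
  intros wf [x Px]. induction x as [x IH] using (well_founded_ind wf).
  destruct (classic (exists y, lt y x /\ P y)) as [[y [Hyx Py]]|no].
  - exact (IH y Hyx Py).
  - exists x. split; [exact Px|]. intros y Hyx Py. eauto.
Qed.

(** * An abstract omega_1 *)

(** [o1_bounded] is the regularity of omega_1, in the form that the closing-off arguments use. *)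
Record is_omega1 (W : Type) (lt : W -> W -> Prop) : Prop := {
  o1_wf : well_founded lt;
  o1_total : forall x y, lt x y \/ x = y \/ lt y x;
  o1_countable : forall x, countable (fun y => lt y x);
  o1_bounded : forall P : W -> Prop, countable P -> exists d, forall x, P x -> lt x d
}.

(* The elements of a well-ordered uncountable set with countably many predecessors. *)
Lemma omega1_exists : exists (W : Type) (lt : W -> W -> Prop), is_omega1 W lt.
Proof.
  destruct (well_ordering (nat -> bool)) as [lt [wf tot]].
  set (C := fun x => countable (fun y => lt y x)).
  (* If [C] were countable, some point would lie outside it. The least such point has all its
     predecessors in [C], hence countably many, and so belongs to [C]. *)
  assert (Cunc : ~ countable C).
  { intro HC.
    destruct (wf_least _ lt (fun x => ~ C x) wf) as [x [nCx Hx]].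
    - apply NNPP. intro no. apply Cantor_diagonal.
      apply countable_sub with C; [|exact HC].
      intros x _. apply NNPP. eauto.
    - apply nCx. apply countable_sub with C; [|exact HC].
      intros y Hy. apply NNPP. exact (Hx y Hy). }
  exists {x | C x}, (fun x y => lt (proj1_sig x) (proj1_sig y)). constructor.
  - apply wf_inverse_image. exact wf.
  - intros [x Cx] [y Cy]. simpl. destruct (tot x y) as [|[<-|]]; auto.
    right. left. f_equal. apply proof_irrelevance.
  - intros [x [f Hf]]. exists (fun y => f (proj1_sig y)).
    intros [y Cy] [z Cz]. simpl. intros Hy Hz E.
    assert (y = z) as <- by auto. f_equal. apply proof_irrelevance.
  (* A countable set without strict upper bound would cover [C] by countably many countable initial
     segments. *)
  - intros P HP. apply NNPP. intro no. apply Cunc.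
    apply countable_sub with
      (fun y => exists x : {x | C x}, P x /\ (y = proj1_sig x \/ lt y (proj1_sig x))).
    + intros y Cy. apply NNPP. intro no'. apply no. exists (exist _ y Cy).
      intros x Px. simpl. destruct (tot (proj1_sig x) y) as [|[H|H]]; auto;
        exfalso; apply no'; exists x; auto.
    + apply countable_bigcup; [exact HP|].
      intros [x Cx] _. simpl. apply countable_add. exact Cx.
Qed.

(** * Oracle computations: use, determinism and countability *)

Lemma cpair_to_nat x y : cpair x y = to_nat (x, y).
Proof.
  unfold cpair. pose proof (to_nat_spec x y) as H.
  replace ((x + y) * (x + y + 1)) with ((to_nat (x, y) - y) * 2) by nia.
  rewrite Nat.div_mul by lia.
  pose proof (to_nat_non_decreasing x y). lia.
Qed.

Lemma cpair_inj x y x' y' : cpair x y = cpair x' y' -> x = x' /\ y = y'.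
Proof. rewrite !cpair_to_nat. apply pair_code_inj. Qed.

Lemma cpair_ge x y : x <= cpair x y /\ y <= cpair x y.
Proof. rewrite cpair_to_nat. pose proof (to_nat_non_decreasing x y). lia. Qed.

(** Needed for unbounded search, where the uses of the [n] failed trials must be merged into one. *)
Lemma uniform_bound (n : nat) (Q : nat -> nat -> Prop) :
  (forall m N N', N <= N' -> Q m N -> Q m N') ->
  (forall m, m < n -> exists N, Q m N) -> exists N, forall m, m < n -> Q m N.
Proof.
  intros mono. induction n as [|n IH]; intro H.
  - exists 0. intros; lia.
  - destruct IH as [N HN]. { intros; apply H; lia. }
    destruct (H n) as [N' HN']; [lia|].
    exists (max N N'). intros m Hm.
    destruct (Nat.eq_dec m n) as [->|].
    + apply mono with N'; [lia|exact HN'].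
    + apply mono with N; [lia|apply HN; lia].
Qed.

Definition agree (X Y : nat -> bool) (N : nat) := forall n, n < N -> X n = Y n.

Lemma agree_le X Y N N' : N <= N' -> agree X Y N' -> agree X Y N.
Proof. intros HN HA n Hn. apply HA. lia. Qed.

(** The use principle: a derivation is well-founded and finitely branching, so it consults finitely
    many oracle bits. *)
Fixpoint eval_use X c v y (H : eval X c v y) {struct H} :
  exists N, forall Y, agree X Y N -> eval Y c v y
with evals_use X cs v ys (H : evals X cs v ys) {struct H} :
  exists N, forall Y, agree X Y N -> evals Y cs v ys.
Proof.
  - destruct H as [v|v|i v|v|f gs v ws y H1 H2|f g v y H1 H2|f g v n z y H1 H2 H3|f v n H1 H2].
    + exists 0. intros; constructor.
    + exists 0. intros; constructor.
    + exists 0. intros; constructor.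
    + exists (S (nth 0 v 0)). intros Y HY. rewrite (HY (nth 0 v 0)) by lia. constructor.
    + destruct (evals_use _ _ _ _ H1) as [N1 HN1].
      destruct (eval_use _ _ _ _ H2) as [N2 HN2].
      exists (max N1 N2). intros Y HY.
      apply eComp with ws; [apply HN1|apply HN2]; apply agree_le with (2 := HY); lia.
    + destruct (eval_use _ _ _ _ H2) as [N2 HN2].
      exists N2. intros Y HY. apply ePrim0; auto.
    + destruct (eval_use _ _ _ _ H2) as [N1 HN1].
      destruct (eval_use _ _ _ _ H3) as [N2 HN2].
      exists (max N1 N2). intros Y HY.
      apply ePrimS with n z; [exact H1|apply HN1|apply HN2];
        apply agree_le with (2 := HY); lia.
    + destruct (eval_use _ _ _ _ H1) as [N1 HN1].
      assert (E : forall m, m < n -> exists N,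
                 forall Y, agree X Y N -> exists k, eval Y f (m :: v) (S k)).
      { intros m Hm. destruct (H2 m Hm) as [k Hk].
        destruct (eval_use _ _ _ _ Hk) as [N HN]. exists N. eauto. }
      apply uniform_bound in E as [N2 HN2].
      2:{ intros m N N' HN HQ Y HY. apply HQ. apply agree_le with (2 := HY); lia. }
      exists (max N1 N2). intros Y HY. apply eMu.
      * apply HN1. apply agree_le with (2 := HY); lia.
      * intros m Hm. apply HN2; [exact Hm|]. apply agree_le with (2 := HY); lia.
  - destruct H as [v|g gs v w ws H1 H2].
    + exists 0. intros; constructor.
    + destruct (eval_use _ _ _ _ H1) as [N1 HN1].
      destruct (evals_use _ _ _ _ H2) as [N2 HN2].
      exists (max N1 N2). intros Y HY.
      constructor; [apply HN1|apply HN2]; apply agree_le with (2 := HY); lia.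
Qed.

Fixpoint eval_fun X c v y (H : eval X c v y) {struct H} :
  forall y', eval X c v y' -> y = y'
with evals_fun X cs v ys (H : evals X cs v ys) {struct H} :
  forall ys', evals X cs v ys' -> ys = ys'.
Proof.
  - destruct H as [v|v|i v|v|f gs v ws y H1 H2|f g v y H1 H2|f g v n z y H1 H2 H3|f v n H1 H2];
      intros y' H'; inversion H'; subst; try reflexivity; try congruence.
    + match goal with H : evals _ gs _ ?w, K : eval _ f ?w y' |- _ =>
        pose proof (evals_fun _ _ _ _ H1 _ H); subst w; exact (eval_fun _ _ _ _ H2 _ K) end.
    + eauto.
    + assert (n0 = n) as -> by congruence.
      match goal with H : eval _ (PPrim f g) _ ?w, K : eval _ g (n :: ?w :: _) y' |- _ =>
        pose proof (eval_fun _ _ _ _ H2 _ H); subst w; exact (eval_fun _ _ _ _ H3 _ K) end.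
    (* If two searches stopped at different places, the smaller one would give both 0 and a
       successor as a value of [f]. *)
    + destruct (lt_eq_lt_dec n y') as [[Hlt|Heq]|Hlt]; [|exact Heq|].
      * match goal with H : forall m, m < y' -> _ |- _ => destruct (H n Hlt) as [k Hk] end.
        discriminate (eval_fun _ _ _ _ H1 _ Hk).
      * destruct (H2 y' Hlt) as [k Hk].
        match goal with H : eval _ f _ 0 |- _ => discriminate (eval_fun _ _ _ _ Hk _ H) end.
  - destruct H as [v|g gs v w ws H1 H2]; intros ys' H'; inversion H'; subst.
    + reflexivity.
    + f_equal; eauto.
Qed.

Fixpoint prf_code (c : prf) : nat :=
  match c with
  | PZero => to_nat (0, 0)
  | PSucc => to_nat (1, 0)
  | PProj i => to_nat (2, i)
  | POracle => to_nat (3, 0)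
  | PComp f gs =>
      to_nat (4, to_nat (prf_code f,
        (fix codes l := match l with [] => 0 | g :: l => S (to_nat (prf_code g, codes l)) end) gs))
  | PPrim f g => to_nat (5, to_nat (prf_code f, prf_code g))
  | PMu f => to_nat (6, prf_code f)
  end.

Fixpoint prf_code_inj (c d : prf) {struct c} : prf_code c = prf_code d -> c = d.
Proof.
  destruct c as [| |i| |f gs|f g|f], d as [| |i'| |f' gs'|f' g'|f'];
    cbn [prf_code]; intro E; apply pair_code_inj in E as [E1 E2]; try discriminate;
    try reflexivity.
  - congruence.
  - apply pair_code_inj in E2 as [Ef Egs]. f_equal; [auto|].
    clear E1 Ef. revert gs' Egs.
    induction gs as [|g gs IH]; intros [|g' gs'] Egs; try discriminate; [reflexivity|].
    injection Egs as Egs. apply pair_code_inj in Egs as [Eg Egs].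
    f_equal; auto.
  - apply pair_code_inj in E2 as [Ef Eg]. f_equal; auto.
  - f_equal; auto.
Qed.

Lemma countable_prf : countable (fun _ : prf => True).
Proof. exists prf_code. intros c d _ _. apply prf_code_inj. Qed.

(** * Order types with values in omega_1 *)

Section Omega1.
Variables (W : Type) (lt : W -> W -> Prop).
Hypothesis HW : is_omega1 W lt.
Local Infix "<<" := lt (at level 70).

Lemma ltW_ind (P : W -> Prop) :
  (forall t, (forall s, s << t -> P s) -> P t) -> forall t, P t.
Proof. exact (well_founded_ind (o1_wf _ _ HW) P). Qed.

Lemma ltW_irrefl t : ~ t << t.
Proof. induction t as [t IH] using ltW_ind. intro H. exact (IH t H H). Qed.

Lemma ltW_asym s t : s << t -> ~ t << s.
Proof.
  revert t. induction s as [s IH] using ltW_ind. intros t Hst Hts.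
  exact (IH t Hts s Hts Hst).
Qed.

Lemma ltW_trans r s t : r << s -> s << t -> r << t.
Proof.
  intros Hrs Hst. destruct (o1_total _ _ HW r t) as [|[<-|Htr]]; auto.
  - exfalso. exact (ltW_asym _ _ Hrs Hst).
  - exfalso. revert s t Hrs Hst Htr.
    induction r as [r IH] using ltW_ind. intros s t Hrs Hst Htr.
    exact (IH t Htr r s Htr Hrs Hst).
Qed.

(* [sim L t x]: the rank of [x] in the relation [L] is the ordinal [t]. *)
Inductive sim (L : nat -> nat -> Prop) (t : W) (x : nat) : Prop :=
| sim_intro :
    (forall s, s << t -> exists y, L y x /\ sim L s y) ->
    (forall y, L y x -> exists s, s << t /\ sim L s y) -> sim L t x.

(** If the two ranks differed, the smaller one would also be the rank of some predecessor of [x],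
    which has a still smaller rank as well. Induction on [s] identifies the two. *)
Lemma sim_fun L s t x : sim L s x -> sim L t x -> s = t.
Proof.
  revert t x. induction s as [s IH] using ltW_ind. intros t x [H1 H2] [K1 K2].
  destruct (o1_total _ _ HW s t) as [H|[H|H]]; [|exact H|]; exfalso.
  - destruct (K1 s H) as [y [Hy Sy]]. destruct (H2 y Hy) as [r [Hr Ry]].
    rewrite (IH r Hr s y Ry Sy) in Hr. exact (ltW_irrefl s Hr).
  - destruct (H1 t H) as [y [Hy Ty]]. destruct (K2 y Hy) as [r [Hr Ry]].
    rewrite (IH t H r y Ty Ry) in Hr. exact (ltW_irrefl r Hr).
Qed.

(** Stated through ranks and not through an isomorphism, so that only countable quantifiers occur.
    This makes it a Borel condition on [L], which forcing can decide. *)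
Definition otype (D : nat -> Prop) (L : nat -> nat -> Prop) (g : W) : Prop :=
  (forall s, s << g -> exists x, D x /\ sim L s x) /\
  (forall x, D x -> exists s, s << g /\ sim L s x).

Lemma otype_fun D L g h : otype D L g -> otype D L h -> g = h.
Proof.
  intros [G1 G2] [H1 H2].
  destruct (o1_total _ _ HW g h) as [H|[H|H]]; [|exact H|]; exfalso.
  - destruct (H1 g H) as [x [Dx Sx]]. destruct (G2 x Dx) as [s [Hs Ss]].
    rewrite (sim_fun _ _ _ _ Sx Ss) in Hs. exact (ltW_irrefl _ Hs).
  - destruct (G1 h H) as [x [Dx Sx]]. destruct (H2 x Dx) as [s [Hs Ss]].
    rewrite (sim_fun _ _ _ _ Sx Ss) in Hs. exact (ltW_irrefl _ Hs).
Qed.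

(** An isomorphism preserves ranks. Ranks refer to all predecessors, also those outside the domain,
    hence the demand that the domains be downward closed. *)
Lemma otype_iso D1 L1 D2 L2 g :
  (forall x y, L1 x y -> D1 y -> D1 x) -> (forall x y, L2 x y -> D2 y -> D2 x) ->
  iso_rel D1 L1 D2 L2 -> otype D1 L1 g -> otype D2 L2 g.
Proof.
  intros down1 down2 [f [fD [finj [fsurj fL]]]].
  assert (Hsim : forall t x, D1 x -> sim L1 t x -> sim L2 t (f x)).
  { intro t. induction t as [t IH] using ltW_ind. intros x Dx [H1 H2]. constructor.
    - intros s Hs. destruct (H1 s Hs) as [y [Hy Sy]].
      assert (Dy : D1 y) by eauto.
      exists (f y). split; [apply fL|]; auto.
    - intros y' Hy'. destruct (fsurj y') as [y [Dy <-]]; [eauto|].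
      apply fL in Hy'; auto. destruct (H2 y Hy') as [s [Hs Ss]]. eauto. }
  intros [H1 H2]. split.
  - intros s Hs. destruct (H1 s Hs) as [x [Dx Sx]]. eauto.
  - intros x' Dx'. destruct (fsurj x' Dx') as [x [Dx <-]].
    destruct (H2 x Dx) as [s [Hs Ss]]. eauto.
Qed.

Lemma sim_lt D L x y s t :
  (forall x y, D x -> D y -> x = y \/ L x y \/ L y x) ->
  D x -> D y -> sim L s x -> sim L t y -> (L x y <-> s << t).
Proof.
  intros tot Dx Dy Sx Ty.
  assert (HL : forall x y s t, sim L s x -> sim L t y -> L x y -> s << t).
  { intros x' y' s' t' Sx' [_ H2] Hxy. destruct (H2 x' Hxy) as [r [Hr Rx]].
    now rewrite (sim_fun _ _ _ _ Sx' Rx). }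
  split; [eauto|]. intro Hst.
  destruct (tot x y Dx Dy) as [E|[H|H]]; [|exact H|]; exfalso.
  - subst. rewrite (sim_fun _ _ _ _ Sx Ty) in Hst. exact (ltW_irrefl _ Hst).
  - exact (ltW_asym _ _ Hst (HL _ _ _ _ Ty Sx H)).
Qed.

Lemma sim_inj D L x y s :
  (forall x y, D x -> D y -> x = y \/ L x y \/ L y x) ->
  D x -> D y -> sim L s x -> sim L s y -> x = y.
Proof.
  intros tot Dx Dy Sx Sy.
  destruct (tot x y Dx Dy) as [E|[H|H]]; [exact E| |]; exfalso; apply (ltW_irrefl s).
  - now apply (sim_lt D L x y).
  - now apply (sim_lt D L y x).
Qed.

(** The isomorphism matches elements of equal rank. *)
Lemma iso_otype D1 L1 D2 L2 g :
  (forall x y, D1 x -> D1 y -> x = y \/ L1 x y \/ L1 y x) ->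
  (forall x y, D2 x -> D2 y -> x = y \/ L2 x y \/ L2 y x) ->
  otype D1 L1 g -> otype D2 L2 g -> iso_rel D1 L1 D2 L2.
Proof.
  intros tot1 tot2 [H1 H2] [K1 K2].
  destruct (choice (fun x y => D1 x -> D2 y /\ exists s, sim L1 s x /\ sim L2 s y))
    as [f Hf].
  { intro x. destruct (classic (D1 x)) as [Dx|]; [|exists 0; tauto].
    destruct (H2 x Dx) as [s [Hs Ss]]. destruct (K1 s Hs) as [y [Dy Sy]]. eauto. }
  exists f. repeat split.
  - intros x Dx. apply Hf, Dx.
  - intros x y Dx Dy E. destruct (Hf x Dx) as [Dfx [s [Sx Sfx]]].
    destruct (Hf y Dy) as [Dfy [t [Ty Tfy]]]. rewrite E in Sfx.
    rewrite (sim_fun _ _ _ _ Sfx Tfy) in Sx. now apply (sim_inj D1 L1 x y t).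
  - intros y Dy. destruct (K2 y Dy) as [s [Hs Ss]]. destruct (H1 s Hs) as [x [Dx Sx]].
    exists x. split; [exact Dx|].
    destruct (Hf x Dx) as [Dfx [t [Tx Tfx]]].
    rewrite (sim_fun _ _ _ _ Tx Sx) in Tfx. now apply (sim_inj D2 L2 (f x) y s).
  - destruct (Hf x H) as [Dfx [s [Sx Sfx]]]. destruct (Hf y H0) as [Dfy [t [Ty Tfy]]].
    intro Hxy. apply (sim_lt D2 L2 (f x) (f y) s t); auto.
    now apply (sim_lt D1 L1 x y s t).
  - destruct (Hf x H) as [Dfx [s [Sx Sfx]]]. destruct (Hf y H0) as [Dfy [t [Ty Tfy]]].
    intro Hxy. apply (sim_lt D1 L1 x y s t); auto.
    now apply (sim_lt D2 L2 (f x) (f y) s t).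
Qed.

Lemma otype_exists (a : WO) : exists g, otype (wdom a) (wrel a) g.
Proof.
  (* [g] is the least ordinal that is not a rank of an element of [P]. It exists because the ranks
     on [P] form a countable, hence bounded, set. *)
  assert (least : forall P : nat -> Prop, exists g,
     (forall x s, P x -> sim (wrel a) s x -> s <> g) /\
     (forall s, s << g -> exists x, P x /\ sim (wrel a) s x)).
  { intro P.
    destruct (wf_least _ lt (fun s => ~ exists x, P x /\ sim (wrel a) s x) (o1_wf _ _ HW))
      as [g [ng Hg]].
    - destruct (o1_bounded _ _ HW (fun s => exists x, P x /\ sim (wrel a) s x)) as [d Hd].
      + apply countable_bigcup; [apply countable_nat|].
        intros x _. exists (fun _ => 0). intros s t Hs Ht _. exact (sim_fun _ _ _ _ Hs Ht).
      + exists d. intro H. exact (ltW_irrefl d (Hd d H)).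
    - exists g. split.
      + intros x s Px Sx ->. eauto.
      + intros s Hs. apply NNPP. exact (Hg s Hs). }
  (* On a downward closed [P] no rank exceeds that [g]: otherwise [g] would be the rank of a
     predecessor, again in [P]. *)
  assert (key : forall P : nat -> Prop,
     (forall x y, P y -> wrel a x y -> P x) -> (forall x, P x -> exists t, sim (wrel a) t x) ->
     exists g, otype P (wrel a) g).
  { intros P down HP. destruct (least P) as [g [G1 G2]]. exists g. split; [exact G2|].
    intros x Px. destruct (HP x Px) as [t Tx]. exists t. split; [|exact Tx].
    destruct (o1_total _ _ HW t g) as [H|[H|H]]; [exact H| |]; exfalso.
    - exact (G1 x t Px Tx H).
    - destruct Tx as [T1 T2]. destruct (T1 g H) as [y [Hy Gy]].
      exact (G1 y g (down y x Px Hy) Gy eq_refl). }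
  assert (Hrank : forall x, wdom a x -> exists t, sim (wrel a) t x).
  { intros x Dx. pose proof (wrel_wf a x Dx) as A. clear Dx. induction A as [x _ IH].
    destruct (key (fun y => wrel a y x)) as [g [G1 G2]].
    - intros y z Hz Hyz. eapply wrel_trans; eauto.
    - exact IH.
    - exists g. constructor; assumption. }
  apply key; [|exact Hrank]. intros x y _ Hxy. exact (proj1 (wrel_dom a x y Hxy)).
Qed.

(** An injection [i] carries the predecessors of [g] with their order to a subset of [nat], where
    [i s] gets rank [s]. *)
Lemma WO_of_otype (g : W) : exists a : WO, otype (wdom a) (wrel a) g.
Proof.
  destruct (o1_countable _ _ HW g) as [i Hi].
  set (D := fun n => exists x, x << g /\ i x = n).
  set (R := fun n m => exists x y, x << g /\ y << g /\ x << y /\ i x = n /\ i y = m).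
  assert (Rdom : forall n m, R n m -> D n /\ D m).
  { intros n m (x & y & Hx & Hy & Hxy & E1 & E2). split; [exists x|exists y]; auto. }
  assert (Rirr : forall n, ~ R n n).
  { intros n (x & y & Hx & Hy & Hxy & E1 & E2).
    rewrite (Hi x y) in Hxy; [|assumption..|congruence]. exact (ltW_irrefl _ Hxy). }
  assert (Rtrans : forall n m k, R n m -> R m k -> R n k).
  { intros n m k (x & y & Hx & Hy & Hxy & E1 & E2) (y' & z & Hy' & Hz & Hyz & E3 & E4).
    rewrite (Hi y' y) in Hyz; [|assumption..|congruence].
    exists x, z. repeat split; auto. exact (ltW_trans _ _ _ Hxy Hyz). }
  assert (Rtot : forall n m, D n -> D m -> n = m \/ R n m \/ R m n).
  { intros n m (x & Hx & E1) (y & Hy & E2).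
    destruct (o1_total _ _ HW x y) as [H|[H|H]].
    - right. left. exists x, y. auto.
    - left. congruence.
    - right. right. exists y, x. auto. }
  assert (Rwf : forall n, D n -> Acc R n).
  { intros n (x & Hx & <-). induction x as [x IH] using ltW_ind. constructor.
    intros m (y & z & Hy & Hz & Hyz & <- & E).
    rewrite (Hi z x) in Hyz by assumption. auto. }
  exists (Build_WO D R Rdom Rirr Rtrans Rtot Rwf). simpl.
  assert (Hs : forall s, s << g -> sim R s (i s)).
  { induction s as [s IH] using ltW_ind. intro Hs. constructor.
    - intros r Hr. assert (r << g) by (eapply ltW_trans; eauto).
      exists (i r). split; [exists r, s|]; auto.
    - intros n (x & y & Hx & Hy & Hxy & <- & E).
      rewrite (Hi y s) in Hxy by assumption. eauto. }
  split.
  - intros s Hsg. exists (i s). split; [exists s|]; auto.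
  - intros n (x & Hx & <-). eauto.
Qed.

Definition ot (a : WO) : W := proj1_sig (constructive_indefinite_description _ (otype_exists a)).

Lemma ot_spec a : otype (wdom a) (wrel a) (ot a).
Proof. exact (proj2_sig (constructive_indefinite_description _ (otype_exists a))). Qed.

Lemma ot_surj g : exists a, ot a = g.
Proof.
  destruct (WO_of_otype g) as [a Ha]. exists a.
  exact (otype_fun _ _ _ _ (ot_spec a) Ha).
Qed.

Lemma wrel_down a x y : wrel a x y -> wdom a y -> wdom a x.
Proof. intros H _. exact (proj1 (wrel_dom a x y H)). Qed.

Lemma ord_eq_ot a b : ord_eq a b <-> ot a = ot b.
Proof.
  split; intro H.
  - apply (otype_iso _ _ _ _ (ot a)) in H; [|apply wrel_down|apply wrel_down|apply ot_spec].
    exact (otype_fun _ _ _ _ H (ot_spec b)).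
  - apply (iso_otype _ _ _ _ (ot a)); [apply wrel_total|apply wrel_total|apply ot_spec|].
    rewrite H. apply ot_spec.
Qed.

Lemma ord_lt_ot a b : ord_lt a b <-> ot a << ot b.
Proof.
  split.
  - intros [t [Dt H]].
    apply (otype_iso _ _ _ _ (ot a)) in H;
      [|apply wrel_down|intros; eapply wrel_trans; eauto|apply ot_spec].
    (* The two clauses of [sim] at [t] say precisely that the segment below [t] has order type
       [s]. *)
    destruct (ot_spec b) as [_ H2]. destruct (H2 t Dt) as [s [Hs [S1 S2]]].
    now rewrite (otype_fun _ _ _ _ H (conj S1 S2)).
  - intro H. destruct (ot_spec b) as [H1 _]. destruct (H1 _ H) as [t [Dt [T1 T2]]].
    exists t. split; [exact Dt|].
    apply (iso_otype _ _ _ _ (ot a)); [apply wrel_total| |apply ot_spec|split; assumption].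
    intros x y Hx Hy. apply wrel_total; [apply (wrel_dom b x t Hx)|apply (wrel_dom b y t Hy)].
Qed.

(** * Copies induced by enumerations *)

Definition diag (D : nat -> bool) (x y : nat) : Prop := D (cpair x y) = true.

Lemma is_copy_otype a D : is_copy a D -> otype (fun _ => True) (diag D) (ot a).
Proof.
  intros [f [fD [finj [fsurj fL]]]].
  apply (otype_iso (wdom a) (wrel a)); [apply wrel_down|auto| |apply ot_spec].
  (* The given isomorphism goes from the copy to [a]; [h] is its inverse. *)
  destruct (choice (fun y x => wdom a y -> f x = y)) as [h Hh].
  { intro y. destruct (classic (wdom a y)) as [Dy|]; [|exists 0; tauto].
    destruct (fsurj y Dy) as [x [_ Hx]]. eauto. }
  exists h. split; [auto|split; [|split]].
  - intros x y Dx Dy E. rewrite <- (Hh x Dx), <- (Hh y Dy). congruence.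
  - intros x _. exists (f x). split; [auto|]. apply finj; auto.
  - intros x y Dx Dy. unfold diag. rewrite (fL (h x) (h y)) by auto.
    rewrite (Hh x Dx), (Hh y Dy). reflexivity.
Qed.

(* The atomic diagram of the copy that the enumeration [G] induces. *)
Definition BG (G : nat -> W) (n : nat) : bool :=
  if excluded_middle_informative (exists x y, n = cpair x y /\ G x << G y) then true else false.

Lemma BG_diag G x y : diag (BG G) x y <-> G x << G y.
Proof.
  unfold diag, BG. destruct (excluded_middle_informative _) as [(x' & y' & E & H)|no].
  - apply cpair_inj in E as [-> ->]. tauto.
  - split; [discriminate|]. intro H. exfalso. apply no. eauto.
Qed.

(** Both components of a pair are at most its code, so a bit below [N] compares only entries with
    index below [N]. *)
Lemma BG_agree G G' N : (forall n, n < N -> G' n = G n) -> agree (BG G) (BG G') N.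
Proof.
  intros HG n Hn. unfold BG.
  assert (E : (exists x y, n = cpair x y /\ G x << G y) =
              (exists x y, n = cpair x y /\ G' x << G' y)).
  { apply propositional_extensionality.
    split; intros (x & y & E & H); exists x, y; pose proof (cpair_ge x y);
      [rewrite !HG by lia|rewrite !HG in H by lia]; auto. }
  now rewrite E.
Qed.

Definition enumerates (G : nat -> W) (b : W) : Prop :=
  (forall n m, G n = G m -> n = m) /\ (forall x, x << b <-> exists n, G n = x).

(** In the induced order the rank of [n] is [G n], so the ranks are exactly the predecessors of
    [ot b]. *)
Lemma BG_copy G b : enumerates G (ot b) -> is_copy b (BG G).
Proof.
  intros [Ginj Gsurj].
  assert (Hsim : forall t n, G n = t -> sim (diag (BG G)) t n).
  { intro t. induction t as [t IH] using ltW_ind. intros n E. constructor.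
    - intros s Hs. assert (Hb : s << ot b).
      { apply ltW_trans with t; [exact Hs|]. apply Gsurj. eauto. }
      apply Gsurj in Hb as [m Hm]. exists m. split; [|auto].
      apply BG_diag. congruence.
    - intros m Hm. apply BG_diag in Hm. exists (G m). rewrite <- E. split; [exact Hm|].
      apply IH; congruence. }
  apply (iso_otype _ _ _ _ (ot b)); [|apply wrel_total| |apply ot_spec].
  - intros x y _ _. destruct (o1_total _ _ HW (G x) (G y)) as [H|[H|H]].
    + right. left. now apply BG_diag.
    + left. auto.
    + right. right. now apply BG_diag.
  - split.
    + intros s Hs. apply Gsurj in Hs as [n Hn]. exists n. auto.
    + intros n _. exists (G n). split; [|auto]. apply Gsurj. eauto.
Qed.

(* Totality of the computation is dropped: only the pairs with value 1 matter. *)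
Definition Red (c : prf) (al be : W) : Prop :=
  forall G, enumerates G be ->
    otype (fun _ => True) (fun x y => eval (BG G) c [cpair x y] 1) al.

Lemma medv_le_Red a b : medv_le a b -> exists c, Red c (ot a) (ot b).
Proof.
  intros [c Hc]. exists c. intros G HG.
  destruct (Hc _ (BG_copy G b HG)) as [D [HD HaD]].
  apply is_copy_otype in HaD.
  replace (fun x y => eval (BG G) c [cpair x y] 1) with (diag D); [exact HaD|].
  apply functional_extensionality. intro x. apply functional_extensionality. intro y.
  apply propositional_extensionality. unfold diag. specialize (HD (cpair x y)).
  destruct (D (cpair x y)); split; intro H; auto; try discriminate.
  discriminate (eval_fun _ _ _ _ HD _ H).
Qed.
End Omega1.

(** * Forcing with finite injective sequences *)

Section Forcing.
Variables (W : Type).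

Definition pre (G : nat -> W) (n : nat) : list W := map G (seq 0 n).

(** Injectivity is built in, so that quantifying over extensions ranges over conditions only. *)
Definition ext (p q : list W) : Prop := NoDup q /\ exists r, q = p ++ r.

Lemma ext_refl p : NoDup p -> ext p p.
Proof. intro H. split; [exact H|]. exists []. now rewrite app_nil_r. Qed.

Lemma ext_trans p q r : ext p q -> ext q r -> ext p r.
Proof.
  intros [_ [u ->]] [Hr [v ->]]. split; [exact Hr|]. exists (u ++ v). now rewrite app_assoc.
Qed.

Lemma pre_ext G n m : (forall i j, G i = G j -> i = j) -> n <= m -> ext (pre G n) (pre G m).
Proof.
  intros Ginj Hnm. unfold pre. split.
  - apply FinFun.Injective_map_NoDup; [exact Ginj|apply seq_NoDup].
  - exists (map G (seq n (m - n))). rewrite <- map_app. f_equal.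
    replace m with (n + (m - n)) at 1 by lia. apply seq_app.
Qed.

Lemma pre_eq G G' n : pre G n = pre G' n <-> forall i, i < n -> G i = G' i.
Proof.
  unfold pre. split.
  - intros E i Hi. apply (ext_in_map E). apply in_seq. lia.
  - intro H. apply map_ext_in. intros i Hi. apply in_seq in Hi. apply H. lia.
Qed.

Definition decides (G : nat -> W) (E : list W -> Prop) : Prop :=
  exists n, E (pre G n) \/ forall q, ext (pre G n) q -> ~ E q.

(* [F p] reads "[p] forces [S]"; deciding each [E k] is the genericity needed for
   forcing to coincide with truth. *)
Definition forcing_for (S : (nat -> W) -> Prop) (F : list W -> Prop) (E : nat -> list W -> Prop) :=
  (forall p q, ext p q -> F p -> F q) /\
  forall G, (forall i j, G i = G j -> i = j) -> (forall k, decides G (E k)) ->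
    (S G <-> exists n, F (pre G n)).

(** Since [E] is indexed by [nat], a sufficiently generic enumeration can be built in omega many
    steps. *)
Definition forceable (S : (nat -> W) -> Prop) : Prop := exists F E, forcing_for S F E.

Lemma forceable_iff (S T : (nat -> W) -> Prop) :
  (forall G, S G <-> T G) -> forceable S -> forceable T.
Proof.
  intros HST (F & E & mono & HF). exists F, E. split; [exact mono|].
  intros G Ginj HG. rewrite <- HST. auto.
Qed.

Lemma forceable_open (S : (nat -> W) -> Prop) :
  (forall G, S G -> exists n, forall G', (forall i, i < n -> G' i = G i) -> S G') -> forceable S.
Proof.
  intro HS.
  (* A condition forces [S] once it contains an initial segment that guarantees [S]. No genericity
     is required, so the sets to be decided are empty. *)
  exists (fun p => exists n G, (exists r, p = pre G n ++ r) /\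
            forall G', (forall i, i < n -> G' i = G i) -> S G'), (fun _ _ => False).
  split.
  - intros p q [_ [r ->]] (n & G & [u ->] & H). exists n, G. split; [|exact H].
    exists (u ++ r). now rewrite app_assoc.
  - intros G Ginj _. split.
    + intro SG. destruct (HS G SG) as [n Hn]. exists n, n, G. split; [|exact Hn].
      exists []. now rewrite app_nil_r.
    (* The guaranteeing segment comes from another sequence [G']; comparing the first [n] entries
       shows that [G] begins with it too. *)
    + intros (m & n & G' & [r E] & H). apply H.
      assert (Hnm : n <= m).
      { apply (f_equal (@length W)) in E. unfold pre in E.
        rewrite length_app, !length_map, !length_seq in E. lia. }
      apply pre_eq. destruct (pre_ext G n m Ginj Hnm) as [_ [r' E']].
      rewrite E' in E. apply (f_equal (firstn n)) in E.
      assert (L : forall G, length (pre G n) = n).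
      { intro. unfold pre. now rewrite length_map, length_seq. }
      rewrite !firstn_app, !L, Nat.sub_diag, !firstn_O, !app_nil_r in E.
      now rewrite !firstn_all2 in E by (rewrite L; lia).
Qed.

(** A condition forces the negation when no extension forces [S]. For truth to yield a forcing
    condition, [F] itself must be decided, so it joins the family. *)
Lemma forceable_not (S : (nat -> W) -> Prop) : forceable S -> forceable (fun G => ~ S G).
Proof.
  intros (F & E & mono & HF).
  exists (fun p => forall q, ext p q -> ~ F q),
    (fun k => match k with 0 => F | Datatypes.S k => E k end).
  split.
  - intros p q Hpq H r Hqr. apply H. now apply ext_trans with q.
  - intros G Ginj HG. specialize (HF G Ginj (fun k => HG (Datatypes.S k))). split.
    + intro nS. destruct (HG 0) as [n [H|H]]; [|eauto].
      exfalso. apply nS, HF. eauto.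
    + intros [n H] SG. apply HF in SG as [m Hm].
      apply (H (pre G (max n m))).
      * apply pre_ext; [exact Ginj|lia].
      * apply mono with (pre G m); [|exact Hm]. apply pre_ext; [exact Ginj|lia].
Qed.

(** An existential statement is forced by forcing one instance; pairing merges the countably many
    families into one. *)
Lemma forceable_exists_nat (S : nat -> (nat -> W) -> Prop) :
  (forall i, forceable (S i)) -> forceable (fun G => exists i, S i G).
Proof.
  intro HS. destruct (choice (fun i F => exists E, forcing_for (S i) F E) HS) as [F HF].
  destruct (choice (fun i E => forcing_for (S i) (F i) E) HF) as [E HE].
  exists (fun p => exists i, F i p), (fun k => E (fst (of_nat k)) (snd (of_nat k))).
  split.
  - intros p q Hpq [i Hi]. exists i. apply (proj1 (HE i) p); assumption.
  - intros G Ginj HG.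
    assert (Hi : forall i, S i G <-> exists n, F i (pre G n)).
    { intro i. apply HE; [exact Ginj|]. intro k.
      specialize (HG (to_nat (i, k))). now rewrite cancel_of_to in HG. }
    split.
    + intros [i Si]. apply Hi in Si as [n Hn]. eauto.
    + intros [n [i Hn]]. exists i. apply Hi. eauto.
Qed.

Lemma forceable_False : forceable (fun _ => False).
Proof. apply forceable_open. intros G []. Qed.

Lemma forceable_exists (I : Type) (P : I -> Prop) (S : I -> (nat -> W) -> Prop) :
  countable P -> (forall i, P i -> forceable (S i)) ->
  forceable (fun G => exists i, P i /\ S i G).
Proof.
  intros [f Hf] HS.
  apply forceable_iff with (fun G => exists n, exists i, (P i /\ f i = n) /\ S i G).
  { intro G. split; [intros (n & i & [Pi _] & H)|intros (i & Pi & H)]; eauto 6. }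
  apply forceable_exists_nat. intro n.
  destruct (classic (exists i, P i /\ f i = n)) as [[i [Pi Ei]]|no].
  - apply forceable_iff with (S i); [|auto].
    intro G. split; [eauto|]. intros (j & [Pj Ej] & H).
    now rewrite (Hf i j) by congruence.
  - apply forceable_iff with (fun _ => False); [|apply forceable_False].
    intro G. split; [tauto|]. intros (j & Hj & _). eauto.
Qed.

Lemma forceable_forall (I : Type) (P : I -> Prop) (S : I -> (nat -> W) -> Prop) :
  countable P -> (forall i, P i -> forceable (S i)) ->
  forceable (fun G => forall i, P i -> S i G).
Proof.
  intros HP HS.
  apply forceable_iff with (fun G => ~ exists i, P i /\ ~ S i G).
  { intro G. split.
    - intros H i Pi. apply NNPP. eauto.
    - intros H (i & Pi & nS). auto. }
  apply forceable_not, forceable_exists; [exact HP|].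
  intros i Pi. apply forceable_not. auto.
Qed.

Lemma forceable_and (S T : (nat -> W) -> Prop) :
  forceable S -> forceable T -> forceable (fun G => S G /\ T G).
Proof.
  intros HS HT.
  apply forceable_iff with (fun G => forall b : bool, True -> (if b then S else T) G).
  { intro G. split.
    - intro H. exact (conj (H true I) (H false I)).
    - intros [H1 H2] [] _; assumption. }
  apply forceable_forall; [|intros [] _; assumption].
  exists (fun b : bool => if b then 0 else 1). intros [] [] _ _; congruence.
Qed.

Lemma forceable_imp (S T : (nat -> W) -> Prop) :
  forceable S -> forceable T -> forceable (fun G => S G -> T G).
Proof.
  intros HS HT.
  apply forceable_iff with (fun G => ~ (S G /\ ~ T G)).
  { intro G. split; [|tauto]. intros H SG. apply NNPP. tauto. }
  apply forceable_not, forceable_and, forceable_not; assumption.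
Qed.

End Forcing.

(** * Generic enumerations of a countable ordinal *)

Section Generic.
Variables (W : Type) (lt : W -> W -> Prop).
Hypothesis HW : is_omega1 W lt.
Local Infix "<<" := lt (at level 70).

(** The computed relation is open by the use principle. Induction on the rank then handles [sim],
    because its quantifiers range over [nat] or over the countably many predecessors of an
    ordinal. *)
Lemma forceable_otype c al :
  forceable W (fun G => otype W lt (fun _ => True) (fun x y => eval (BG W lt G) c [cpair x y] 1) al).
Proof.
  set (L := fun G x y => eval (BG W lt G) c [cpair x y] 1).
  assert (HL : forall x y, forceable W (fun G => L G x y)).
  { intros x y. apply forceable_open. intros G H.
    destruct (eval_use _ _ _ _ H) as [N HN]. exists N.
    intros G' HG'. apply HN. now apply BG_agree. }
  assert (Hsim : forall t x, forceable W (fun G => sim W lt (L G) t x)).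
  { intro t. induction t as [t IH] using (ltW_ind W lt HW). intro x.
    apply forceable_iff with (fun G =>
      (forall s, s << t -> exists y, L G y x /\ sim W lt (L G) s y) /\
      (forall y, True -> L G y x -> exists s, s << t /\ sim W lt (L G) s y)).
    { intro G. split; [intros [H1 H2]; constructor; auto|intros [H1 H2]; split; auto]. }
    apply forceable_and.
    - apply forceable_forall; [apply (o1_countable _ _ HW)|]. intros s Hs.
      apply forceable_exists_nat. intro y. apply forceable_and; auto.
    - apply forceable_forall; [apply countable_nat|]. intros y _.
      apply forceable_imp; [apply HL|].
      apply forceable_exists; [apply (o1_countable _ _ HW)|auto]. }
  unfold otype. apply forceable_and.
  - apply forceable_forall; [apply (o1_countable _ _ HW)|]. intros s _.
    apply forceable_iff with (fun G => exists x, sim W lt (L G) s x).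
    { intro G. split; [intros [x Hx]|intros (x & _ & Hx)]; eauto. }
    apply forceable_exists_nat. auto.
  - apply forceable_forall; [apply countable_nat|]. intros x _.
    apply forceable_exists; [apply (o1_countable _ _ HW)|auto].
Qed.

Definition below (b : W) (p : list W) : Prop := forall x, In x p -> x << b.

Lemma below_bounded b p : (exists x, x << b) -> below b p ->
  exists m, m << b /\ forall x, In x p -> x << m \/ x = m.
Proof.
  intros [x0 Hx0]. induction p as [|a p IH]; intro Hp.
  - exists x0. split; [exact Hx0|]. intros x [].
  - destruct IH as [m [Hm IH]]. { intros x Hx. apply Hp. now right. }
    assert (Ha : a << b) by (apply Hp; now left).
    destruct (o1_total _ _ HW a m) as [H|[H|H]].
    + exists m. split; [exact Hm|]. intros x [<-|Hx]; auto.
    + exists m. split; [exact Hm|]. intros x [<-|Hx]; auto.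
    + exists a. split; [exact Ha|]. intros x [<-|Hx]; [auto|].
      destruct (IH x Hx) as [Hxm| ->]; [|auto]. left. eapply ltW_trans; eauto.
Qed.

Definition limit (b : W) : Prop :=
  (exists x, x << b) /\ forall x, x << b -> exists y, x << y /\ y << b.

(** An elementarity requirement: a condition below [b] that cannot be extended into [E] below [b]
    cannot be extended into [E] at all. *)
Definition closed_under (b : W) (E : list W -> Prop) : Prop :=
  forall p, below b p -> (exists q, ext W p q /\ E q) -> exists q, ext W p q /\ E q /\ below b q.

(** A Rasiowa-Sikorski construction. Stage [k] lengthens the condition, adds the element of [b]
    coded by [k], and enters [E k] if any extension does; [closed_under] keeps the result below
    [b]. *)
Lemma generic_exists b (E : nat -> list W -> Prop) p0 :
  limit b -> (forall k, closed_under b (E k)) -> NoDup p0 -> below b p0 ->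
  exists G, enumerates W lt G b /\ (exists n, pre W G n = p0) /\ forall k, decides W G (E k).
Proof.
  intros [b0 blim] HE Np0 Bp0.
  destruct (o1_countable _ _ HW b) as [f Hf].
  assert (add : forall p x, NoDup p -> below b p -> x << b -> exists q, ext W p q /\ below b q /\ In x q).
  { intros p x Np Bp Hx. destruct (classic (In x p)) as [Hin|Hin].
    - exists p. split; [apply ext_refl|]; auto.
    - exists (p ++ [x]). split; [split; [|eauto]|split].
      + apply NoDup_app; [exact Np|constructor; [intros []|constructor]|].
        intros y Hy [<-|[]]. auto.
      + intros y Hy. apply in_app_or in Hy as [Hy|[<-|[]]]; auto.
      + apply in_or_app. right. now left. }
  assert (step : forall k p, exists q, NoDup p /\ below b p -> ext W p q /\ below b q /\
            length p < length q /\ (forall x, x << b -> f x = k -> In x q) /\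
            (E k q \/ forall r, ext W q r -> ~ E k r)).
  { intros k p. destruct (classic (NoDup p /\ below b p)) as [[Np Bp]|]; [|exists p; tauto].
    assert (H1 : exists q, ext W p q /\ below b q /\ length p < length q).
    (* As [b] is a limit, there is an element [y] of [b] above the maximum of [p]; it is new, so
       adding it increases the length. *)
    { destruct (below_bounded b p b0 Bp) as [m [Hm Hmax]].
      destruct (blim m Hm) as [y [Hmy Hy]]. destruct (add p y Np Bp Hy) as [q [Hq [Bq Iq]]].
      exists q. split; [exact Hq|split; [exact Bq|]].
      destruct Hq as [Nq [[|z r] ->]]; [|rewrite length_app; simpl; lia].
      exfalso. rewrite app_nil_r in Iq. apply (ltW_irrefl _ _ HW y).
      destruct (Hmax y Iq) as [H| ->]; [|exact Hmy]. eapply ltW_trans; eauto. }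
    destruct H1 as [q1 [E1 [B1 L1]]].
    assert (H2 : exists q, ext W q1 q /\ below b q /\ forall x, x << b -> f x = k -> In x q).
    { destruct (classic (exists x, x << b /\ f x = k)) as [[x [Hx Ex]]|no].
      - destruct (add q1 x (proj1 E1) B1 Hx) as [q [Hq [Bq Iq]]].
        exists q. split; [exact Hq|split; [exact Bq|]]. intros y Hy Ey.
        now rewrite (Hf y x) by congruence.
      - exists q1. split; [apply ext_refl, E1|split; [exact B1|]].
        intros x Hx Ex. exfalso. eauto. }
    destruct H2 as [q2 [E2 [B2 I2]]].
    assert (L : forall q q', ext W q q' -> length q <= length q' /\ forall x, In x q -> In x q').
    { intros q q' [_ [r ->]]. split; [rewrite length_app; lia|].
      intros x Hx. apply in_or_app. now left. }
    assert (E12 := ext_trans _ _ _ _ E1 E2).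
    destruct (classic (exists q, ext W q2 q /\ E k q)) as [Hq|Hq].
    - destruct (HE k q2 B2 Hq) as [q3 [E3 [Ek B3]]].
      exists q3. intros _. repeat split; auto.
      + exact (proj1 E3).
      + exact (proj2 (ext_trans _ _ _ _ E12 E3)).
      + pose proof (proj1 (L _ _ E2)). pose proof (proj1 (L _ _ E3)). lia.
      + intros x Hx Ex. apply (L _ _ E3). auto.
    - exists q2. intros _. split; [exact E12|]. repeat split; auto.
      + pose proof (proj1 (L _ _ E2)). lia.
      + right. intros r Hr Er. eauto. }
  destruct (choice (fun kp q => NoDup (snd kp) /\ below b (snd kp) ->
      ext W (snd kp) q /\ below b q /\ length (snd kp) < length q /\
      (forall x, x << b -> f x = fst kp -> In x q) /\
      (E (fst kp) q \/ forall r, ext W q r -> ~ E (fst kp) r))) as [next Hnext].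
  { intros [k p]. apply step. }
  set (P := nat_rect (fun _ => list W) p0 (fun k p => next (k, p))).
  assert (HP : forall k, NoDup (P k) /\ below b (P k)).
  { induction k as [|k IH]; [split; assumption|].
    destruct (Hnext (k, P k) IH) as [[N _] [B _]]. split; [exact N|exact B]. }
  assert (Pstep := fun k => Hnext (k, P k) (HP k)). simpl in Pstep.
  assert (Pmono : forall k l, k <= l -> ext W (P k) (P l)).
  { intros k l Hkl. induction Hkl as [|l _ IH]; [apply ext_refl, HP|].
    apply ext_trans with (1 := IH). apply Pstep. }
  assert (Plen : forall k, k <= length (P k)).
  { induction k as [|k IH]; [lia|]. destruct (Pstep k) as [_ [_ [H _]]].
    simpl in *. lia. }
  destruct b0 as [x0 Hx0].
  (* [P (S i)] has length at least [S i], so the default [x0] is never returned. *)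
  set (G := fun i => nth i (P (S i)) x0).
  assert (HG : forall k i, i < length (P k) -> G i = nth i (P k) x0).
  { intros k i Hi. unfold G. destruct (Nat.le_ge_cases k (S i)) as [H|H].
    - destruct (Pmono _ _ H) as [_ [r ->]]. now rewrite app_nth1.
    - destruct (Pmono _ _ H) as [_ [r ->]]. rewrite app_nth1; [reflexivity|].
      pose proof (Plen (S i)). lia. }
  assert (Gpre : forall k, pre W G (length (P k)) = P k).
  { intro k. apply nth_ext with (d := x0) (d' := x0).
    - unfold pre. now rewrite length_map, length_seq.
    - unfold pre. rewrite length_map, length_seq. intros i Hi.
      rewrite nth_indep with (d' := G 0) by (rewrite length_map, length_seq; lia).
      rewrite map_nth, seq_nth by lia. simpl. now apply HG. }
  exists G. split; [split|split].
  - intros n m Enm. pose proof (Plen (S (max n m))).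
    rewrite (HG (S (max n m)) n), (HG (S (max n m)) m) in Enm by lia.
    apply (proj1 (NoDup_nth (P (S (max n m))) x0) (proj1 (HP _))) in Enm; [exact Enm|lia|lia].
  - intro x. split.
    + intro Hx. destruct (Pstep (f x)) as [_ [_ [_ [Hin _]]]].
      specialize (Hin x Hx eq_refl). change (next (f x, P (f x))) with (P (S (f x))) in Hin.
      apply (In_nth _ _ x0) in Hin as [n [Hn En]]. exists n. rewrite <- En. now apply HG.
    + intros [n <-]. apply (HP (S n)). apply nth_In. pose proof (Plen (S n)). lia.
  - exists (length p0). exact (Gpre 0).
  - intro k. exists (length (P (S k))). rewrite Gpre. apply Pstep.
Qed.

(* If [be] has a copy with image of type [al], this is forced by some condition; the same
   condition then produces such a copy of [be']. *)
Lemma Red_transfer c al al' be be' F E :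
  forcing_for W (fun G => otype W lt (fun _ => True) (fun x y => eval (BG W lt G) c [cpair x y] 1) al) F E ->
  limit be -> limit be' ->
  (forall k, closed_under be (E k)) -> (forall k, closed_under be' (E k)) ->
  closed_under be' F ->
  Red W lt c al be -> Red W lt c al' be' -> al = al'.
Proof.
  intros [mono HF] lim lim' HE HE' HF' HR HR'.
  destruct (generic_exists be E [] lim HE) as (G & HG & _ & dG); [constructor|intros x []|].
  pose proof (HR G HG) as SG. apply (HF G (proj1 HG) dG) in SG as [n Fn].
  (* [pre W G n] need not lie below [be']. It extends the empty condition, which does, so closure
     supplies another forcing condition [q] below [be']. *)
  destruct (HF' []) as (q & [Nq _] & Fq & Bq).
  { intros x []. }
  { exists (pre W G n). split; [|exact Fn]. apply (pre_ext W G 0 n (proj1 HG)). lia. }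
  destruct (generic_exists be' E q lim' HE' Nq Bq) as (G' & HG' & [m Em] & dG').
  apply (otype_fun W lt HW _ _ _ _) with (2 := HR' G' HG').
  apply (HF G' (proj1 HG') dG'). exists m. now rewrite Em.
Qed.
End Generic.

(** * Closure points and the antichain *)

Lemma countable_In (T : Type) (l : list T) : countable (fun x => In x l).
Proof.
  induction l as [|a l IH].
  - exists (fun _ => 0). intros x y [].
  - apply countable_sub with (fun x => x = a \/ In x l).
    + intros x [->|Hx]; auto.
    + now apply countable_add.
Qed.

Lemma countable_lists (T : Type) (P : T -> Prop) :
  countable P -> countable (fun l => forall x, In x l -> P x).
Proof.
  intros [f Hf]. exists (fold_right (fun x n => S (to_nat (f x, n))) 0).
  intro l. induction l as [|x l IH]; intros [|y m] Hl Hm E; try discriminate; [reflexivity|].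
  cbn [fold_right] in E. injection E as E. apply pair_code_inj in E as [E1 E2].
  f_equal.
  - apply Hf; [apply Hl|apply Hm|exact E1]; now left.
  - apply IH; [| |exact E2]; intros z Hz; [apply Hl|apply Hm]; now right.
Qed.

Section Club.
Variables (W : Type) (lt : W -> W -> Prop).
Hypothesis HW : is_omega1 W lt.
Local Infix "<<" := lt (at level 70).

(** A single [K] of an ordinal parameter and a condition suffices, since countably many requirements
    can be bounded at once. *)
Definition closure_points (K : W -> list W -> W) (b : W) : Prop :=
  (exists x, x << b) /\ forall a p, a << b -> below W lt b p -> K a p << b.

Lemma below_trans a b p : a << b -> below W lt a p -> below W lt b p.
Proof. intros Hab Hp x Hx. apply (ltW_trans W lt HW) with a; auto. Qed.

(** The finitely many arguments of [K] all lie below one closure point under [g]. *)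
Lemma closure_points_closed K g :
  (exists x, x << g) ->
  (forall x, x << g -> exists b, closure_points K b /\ x << b /\ b << g) ->
  closure_points K g.
Proof.
  intros g0 Hg. split; [exact g0|]. intros a p Ha Hp.
  destruct (below_bounded W lt HW g (a :: p) g0) as [m [Hm Hmax]].
  { intros x [<-|Hx]; auto. }
  destruct (Hg m Hm) as [b [[_ Hb] [Hmb Hbg]]].
  assert (Hb' : forall x, In x (a :: p) -> x << b).
  { intros x Hx. destruct (Hmax x Hx) as [H| ->]; [|exact Hmb].
    exact (ltW_trans W lt HW _ _ _ H Hmb). }
  apply (ltW_trans W lt HW) with b; [|exact Hbg].
  apply Hb; [apply Hb'; now left|]. intros x Hx. apply Hb'. now right.
Qed.

Lemma closure_points_unbounded K g : exists b, closure_points K b /\ g << b.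
Proof.
  assert (Hnext : forall c, exists d, c << d /\
            forall a p, a << c -> below W lt c p -> K a p << d).
  { intro c.
    destruct (o1_bounded _ _ HW (fun x => x = c \/
      exists a, a << c /\ exists p, below W lt c p /\ x = K a p)) as [d Hd].
    - apply countable_add, countable_bigcup; [apply (o1_countable _ _ HW)|].
      intros a _. apply countable_range, countable_lists, (o1_countable _ _ HW).
    - exists d. split; [auto|]. intros a p Ha Hp. apply Hd. eauto 6. }
  apply choice in Hnext as [next Hnext].
  set (s := nat_rect (fun _ => W) g (fun _ c => next c)).
  assert (Hs : forall n, s n << s (S n)) by (intro n; apply Hnext).
  (* [b] is the supremum of the increasing sequence [s]; finitely many elements of [b] lie below
     some [s n], and [K] maps them below the next term. *)
  destruct (wf_least _ lt (fun b => forall n, s n << b) (o1_wf _ _ HW)) as [b [Hb Hleast]].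
  { destruct (o1_bounded _ _ HW (fun x => exists n, True /\ x = s n)) as [d Hd].
    - apply countable_range, countable_nat.
    - exists d. eauto. }
  exists b. split; [split|apply (Hb 0)].
  { exists g. apply (Hb 0). }
  intros a p Ha Hp.
  destruct (below_bounded W lt HW b (a :: p)) as [m [Hm Hmax]].
  { eauto. }
  { intros x [<-|Hx]; auto. }
  destruct (not_all_ex_not _ _ (Hleast m Hm)) as [n Hn].
  assert (Hmn : m << s (S n)).
  { destruct (o1_total _ _ HW (s n) m) as [H|[<-|H]]; [tauto|apply Hs|].
    exact (ltW_trans W lt HW _ _ _ H (Hs n)). }
  assert (Hall : forall x, In x (a :: p) -> x << s (S n)).
  { intros x Hx. destruct (Hmax x Hx) as [H| ->]; [|exact Hmn].
    exact (ltW_trans W lt HW _ _ _ H Hmn). }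
  apply (ltW_trans W lt HW) with (s (S (S n))); [|apply Hb].
  apply Hnext; [apply Hall; now left|]. intros x Hx. apply Hall. now right.
Qed.

Lemma antichain : exists (K : W -> list W -> W) (a0 : W),
  forall c al be, closure_points K al -> closure_points K be -> a0 << al -> a0 << be ->
    Red W lt c al be -> al = be.
Proof.
  (* Index 0 holds the forcing relation and the later indices the sets to be decided, so that one
     closure requirement covers both. *)
  destruct (choice (fun (ca : prf * W) (E : nat -> list W -> Prop) =>
     forcing_for W (fun G => otype W lt (fun _ => True)
        (fun x y => eval (BG W lt G) (fst ca) [cpair x y] 1) (snd ca)) (E 0) (fun k => E (S k))))
    as [E HE].
  { intros [c al]. destruct (forceable_otype W lt HW c al) as (F & E & H).
    exists (fun k => match k with 0 => F | S k => E k end). exact H. }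
  (* [f (c, be)] is the type, if any, to which [c] sends every copy of [be]; the default is [be]. *)
  destruct (choice (fun (cb : prf * W) al =>
     (exists a, Red W lt (fst cb) a (snd cb)) -> Red W lt (fst cb) al (snd cb))) as [f Hf].
  { intros [c be]. simpl. destruct (classic (exists a, Red W lt c a be)) as [[a Ha]|no].
    - exists a. auto.
    - exists be. tauto. }
  destruct (choice (fun (ap : W * list W) d => fst ap << d /\
     (forall c, f (c, fst ap) << d) /\
     forall c k, (exists q, ext W (snd ap) q /\ E (c, fst ap) k q) ->
        exists q, ext W (snd ap) q /\ E (c, fst ap) k q /\ below W lt d q)) as [K0 HK0].
  { intros [a p]. simpl.
    destruct (choice (fun (ck : prf * nat) q => (exists q, ext W p q /\ E (fst ck, a) (snd ck) q) ->
       ext W p q /\ E (fst ck, a) (snd ck) q)) as [w Hw].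
    { intros [c k]. simpl.
      destruct (classic (exists q, ext W p q /\ E (c, a) k q)) as [[q Hq]|no].
      - exists q. auto.
      - exists p. tauto. }
    (* The bound exceeds [a], which makes closure points limits, the values [f (c, a)], and all
       entries of the chosen witnesses. *)
    destruct (o1_bounded _ _ HW (fun x => x = a \/ exists c, True /\
       (x = f (c, a) \/ exists k, True /\ In x (w (c, k))))) as [d Hd].
    - apply countable_add, countable_bigcup; [apply countable_prf|]. intros c _.
      apply countable_add, countable_bigcup; [apply countable_nat|]. intros k _.
      apply countable_In.
    - exists d. split; [auto|split]; [eauto 6|].
      intros c k Hq. exists (w (c, k)). destruct (Hw (c, k) Hq) as [H1 H2].
      split; [exact H1|split; [exact H2|]]. intros x Hx. apply Hd. eauto 8. }
  set (K := fun a p => K0 (a, p)).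
  assert (HK : forall a p, a << K a p /\ (forall c, f (c, a) << K a p) /\
     forall c k, (exists q, ext W p q /\ E (c, a) k q) ->
        exists q, ext W p q /\ E (c, a) k q /\ below W lt (K a p) q).
  { intros a p. exact (HK0 (a, p)). }
  clearbody K. clear K0 HK0.
  assert (Klim : forall b, closure_points K b -> limit W lt b).
  { intros b [b0 Hb]. split; [exact b0|]. intros x Hx. exists (K x []).
    split; [apply HK|]. apply Hb; [exact Hx|intros y []]. }
  assert (Kclosed : forall b c a k, closure_points K b -> a << b -> closed_under W lt b (E (c, a) k)).
  { intros b c a k [_ Hb] Ha p Hp Hq. destruct (HK a p) as [_ [_ H]].
    destruct (H c k Hq) as (q & H1 & H2 & H3). exists q. split; [exact H1|split; [exact H2|]].
    apply below_trans with (K a p); auto. }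
  assert (transfer : forall c al al' be be', closure_points K be -> closure_points K be' ->
     al << be -> al << be' -> Red W lt c al be -> Red W lt c al' be' -> al = al').
  { intros c al al' be be' Hbe Hbe' H1 H2 R1 R2.
    apply (Red_transfer W lt HW c al al' be be' (E (c, al) 0) (fun k => E (c, al) (S k))); auto.
    exact (HE (c, al)). }
  (* By [transfer], [g c] is the only type that [c] can produce from larger closure points lying
     above it; [a0] will exceed all these values. *)
  destruct (choice (fun c g => (exists al be, closure_points K be /\ al << be /\ Red W lt c al be) ->
     exists be, closure_points K be /\ g << be /\ Red W lt c g be)) as [g Hg].
  { intro c. destruct (classic (exists al be, closure_points K be /\ al << be /\ Red W lt c al be))
      as [[al Hal]|no].
    - exists al. auto.
    - destruct (o1_bounded _ _ HW (fun _ => False)) as [d _].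
      + exists (fun _ => 0). tauto.
      + exists d. tauto. }
  destruct (o1_bounded _ _ HW (fun x => exists c, True /\ x = g c)) as [a0 Ha0].
  { apply countable_range, countable_prf. }
  exists K, a0. intros c al be Hal Hbe H0al H0be HR.
  destruct (o1_total _ _ HW al be) as [H|[H|H]]; [|exact H|]; exfalso.
  (* If [al] is the smaller one, [transfer] forces [al] to equal [g c], which lies below [a0] and
     hence below [al]. *)
  - destruct (Hg c) as (be' & Hbe' & Hlt & HR'). { eauto. }
    assert (Hga : g c << al). { apply (ltW_trans W lt HW) with a0; eauto. }
    assert (Hgb : g c << be) by (apply (ltW_trans W lt HW) with al; auto).
    rewrite (transfer c (g c) al be' be) in Hga by auto.
    exact (ltW_irrefl W lt HW _ Hga).
  (* If [al] is the larger one, any enumeration of [be] shows that [al] is [f (c, be)], yet [al] is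
     closed under [f]. The family of sets to decide is empty because mere existence of an
     enumeration is wanted. *)
  - destruct (generic_exists W lt HW be (fun _ _ => False) [] (Klim be Hbe)) as (G & HG & _).
    { intros _ p _ (q & _ & []). }
    { constructor. }
    { intros x []. }
    assert (Efb : f (c, be) = al).
    { apply (otype_fun W lt HW _ _ _ _ (Hf (c, be) (ex_intro _ al HR) G HG) (HR G HG)). }
    destruct (HK be []) as [_ [Hfb _]]. specialize (Hfb c). rewrite Efb in Hfb.
    apply (ltW_asym W lt HW _ _ Hfb). apply Hal; [exact H|intros x []].
Qed.
End Club.

(** * Transfer of the club to representatives *)

Theorem theorem2 :
  exists A : WO -> Prop,
    club A /\
    (forall a b, A a -> A b -> ~ ord_eq a b -> ~ medv_le a b /\ ~ medv_le b a).
Proof.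
  destruct omega1_exists as (W & lt & HW).
  destruct (antichain W lt HW) as (K & a0 & HA).
  set (o := ot W lt HW).
  exists (fun a => closure_points W lt K (o a) /\ lt a0 (o a)). split; [split; [|split]|].
  - intros a b Hab. apply (ord_eq_ot W lt HW) in Hab. unfold o. now rewrite Hab.
  - intros g [a Ha] Hlim. apply (ord_lt_ot W lt HW) in Ha.
    assert (Hlim' : forall x, lt x (o g) -> exists b,
              (closure_points W lt K b /\ lt a0 b) /\ lt x b /\ lt b (o g)).
    { intros x Hx. destruct (ot_surj W lt HW x) as [a' <-].
      destruct (Hlim a') as (b & Hb & H1 & H2); [now apply (ord_lt_ot W lt HW)|].
      exists (o b). split; [exact Hb|]. now split; apply (ord_lt_ot W lt HW). }
    split.
    + apply (closure_points_closed W lt HW).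
      * exists (o a). exact Ha.
      * intros x Hx. destruct (Hlim' x Hx) as (b & [Hb _] & Hxb). eauto.
    + destruct (Hlim' _ Ha) as (b & [_ Hb] & _ & Hbg).
      exact (ltW_trans W lt HW _ _ _ Hb Hbg).
  (* A closure point beyond [d] passes both [a0] and the given ordinal. *)
  - intro a. destruct (o1_bounded _ _ HW (fun x => In x [a0; o a])) as [d Hd].
    { apply countable_In. }
    destruct (closure_points_unbounded W lt HW K d) as [b [Hb Hdb]].
    destruct (ot_surj W lt HW b) as [b' <-]. exists b'. split; [split|].
    + exact Hb.
    + apply (ltW_trans W lt HW) with d; [apply Hd; simpl; auto|exact Hdb].
    + apply (ord_lt_ot W lt HW), (ltW_trans W lt HW) with d; [apply Hd; simpl; auto|exact Hdb].
  - intros a b [Ha Ha0] [Hb Hb0] Hne.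
    split; intro Hle; apply Hne, (ord_eq_ot W lt HW);
      apply (medv_le_Red W lt HW) in Hle as [c Hc]; [|symmetry]; eapply HA; eauto.
Qed.
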